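(* Let $(X,d_X)$ be a complete metric space, let $Y\subset X$ be equipped with the induced length metric $d_Y$, and assume there exists a Hausdorff topology $\sigma$ on $X$ satisfying: (1) $d_X$-bounded sets are relatively sequentially $\sigma$-compact (every $d_X$-bounded sequence has a subsequence that $\sigma$-converges to a point of $X$). (2) $d_X$ is $\sigma\times\sigma$-sequentially lower semicontinuous. (3) $Y$ is a $\sigma$-closed subset of $X$. If $d_Y$ is everywhere finite on $Y\times Y$, then $(Y,d_Y)$ is a complete geodesic space.
   Context: Absolutely continuous curves: $AC([0,1];(X,d_X))$ is the set of maps $\gamma:[0,1]\to X$ for which there is $m\in L^1([0,1])$ with $d_X(\gamma_s,\gamma_t)\le\int_s^tm(u)\,du$ for all $s<t$. The metric derivative is $|\dot\gamma|_t=\limsup_{s\to t}d_X(\gamma_s,\gamma_t)/|s-t|$. Induced length metric: $d_Y(y,y')=\inf\int_0^1|\dot\gamma|_t\,dt$ over $\gamma\in AC([0,1];(X,d_X))$ with $\gamma_t\in Y$ for all $t$, $\gamma_0=y$, $\gamma_1=y'$ ($\inf\emptyset=+\infty$). $(Y,d_Y)$ is a complete geodesic space if it is complete and for every $y,y'\in Y$ there is $\gamma:[0,1]\to Y$ with $\gamma_0=y$, $\gamma_1=y'$, and $d_Y(\gamma_s,\gamma_t)=|t-s|\,d_Y(y,y')<\infty$ for all $s,t\in[0,1]$. *)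

(* Defs.v *)
From HB Require Import structures.
From mathcomp Require Import all_boot all_order all_algebra.
From mathcomp Require Import all_classical all_reals all_analysis.
Set Implicit Arguments.
Unset Strict Implicit.
Unset Printing Implicit Defensive.
Import Order.TTheory GRing.Theory Num.Theory.
Import numFieldNormedType.Exports.
Local Open Scope classical_set_scope.
Local Open Scope ring_scope.

(** The empty set is open, by [topology_bigcup] over an empty index type. *)
Record topology_on (X : choiceType) := TopologyOn {
  topology_open :> set_system X;
  topology_setT : topology_open setT;
  topology_setI : forall A B : set X,
    topology_open A -> topology_open B -> topology_open (A `&` B);
  topology_bigcup : forall (I : Type) (f : I -> set X),
    (forall i, topology_open (f i)) -> topology_open (\bigcup_i f i)
}.

(** An alias of [X] that carries the topology [sigma]: the library notions
    [closed], [hausdorff_space], [-->] at type [retopologize sigma] refer to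
    [sigma], even when [X] has a canonical topology of its own. *)
Definition retopologize (X : choiceType) (sigma : topology_on X) : Type := X.

Section Retopologize.
Context (X : choiceType) (sigma : topology_on X).

HB.instance Definition _ := Choice.copy (retopologize sigma) X.
HB.instance Definition _ := @isOpenTopological.Build (retopologize sigma)
  (topology_open sigma) (topology_setT sigma) (@topology_setI _ sigma)
  (@topology_bigcup _ sigma).

Lemma retopologize_openE (A : set (retopologize sigma)) :
  open A = topology_open sigma A.
Proof. by []. Qed.

Definition hausdorff_topology : Prop := hausdorff_space (retopologize sigma).

Definition closed_for (A : set X) : Prop := @closed (retopologize sigma) A.

Definition seq_cvg_for (u : nat -> X) (x : X) : Prop :=
  (u : nat -> retopologize sigma) @ \oo --> (x : retopologize sigma).

End Retopologize.

Section SigmaAndMetric.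
Context (R : realType) (X : metricType R).

Definition metric_bounded (B : set X) : Prop :=
  exists M : R, forall x y, B x -> B y -> mdist x y <= M.

(** The limit of the subsequence need not lie in [B]. *)
Definition relatively_seq_compact (sigma : topology_on X) (B : set X) : Prop :=
  forall u : nat -> X, (forall n, B (u n)) ->
  exists2 phi : nat -> nat, {homo phi : m n / (m < n)%N} &
  exists x : X, seq_cvg_for sigma (u \o phi) x.

Definition mdist_seq_lsc (sigma : topology_on X) : Prop :=
  forall (u v : nat -> X) (x y : X),
  seq_cvg_for sigma u x -> seq_cvg_for sigma v y ->
  ((mdist x y)%:E <= limn_einf (fun n => (mdist (u n) (v n))%:E))%E.

End SigmaAndMetric.

(** A curve on [0, 1] is a map [R -> X] whose values outside [0, 1] are never
    used. *)
Section LengthMetric.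
Context (R : realType) (X : metricType R).

Definition abs_continuous (gamma : R -> X) : Prop :=
  exists2 m : R -> R,
    (@lebesgue_measure R).-integrable `[0, 1] (EFin \o m) &
    forall s t : R, 0 <= s -> s < t -> t <= 1 ->
    ((mdist (gamma s) (gamma t))%:E <=
      \int[@lebesgue_measure R]_(u in `[s, t]) (m u)%:E)%E.

(** Upper limit as [s] tends to [t] with [s <> t], [s] in [0, 1]. *)
Definition metric_derivative (gamma : R -> X) (t : R) : \bar R :=
  limf_esup (fun s : R => (mdist (gamma s) (gamma t) / `|s - t|)%:E)
            (within `[0, 1] t^').

Definition curve_length (gamma : R -> X) : \bar R :=
  (\int[@lebesgue_measure R]_(t in `[0%R, 1%R]) metric_derivative gamma t)%E.

Definition length_dist (Y : set X) (y y' : X) : \bar R :=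
  ereal_inf [set curve_length gamma | gamma in
    [set gamma : R -> X | [/\ abs_continuous gamma,
      forall t, 0 <= t <= 1 -> Y (gamma t), gamma 0 = y & gamma 1 = y']]].

End LengthMetric.

Section CompleteGeodesic.
Context (R : realType) (X : Type) (Y : set X) (d : X -> X -> \bar R).

Definition complete_dist : Prop :=
  forall u : nat -> X, (forall n, Y (u n)) ->
  (forall e : R, 0 < e -> exists N : nat, forall m n : nat,
    (N <= m)%N -> (N <= n)%N -> (d (u m) (u n) < e%:E)%E) ->
  exists2 y : X, Y y & d (u n) y @[n --> \oo] --> (0 : \bar R)%E.

Definition geodesic_dist : Prop :=
  forall y y' : X, Y y -> Y y' ->
  exists gamma : R -> X,
  [/\ forall t, 0 <= t <= 1 -> Y (gamma t), gamma 0 = y, gamma 1 = y' &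
    forall s t, 0 <= s <= 1 -> 0 <= t <= 1 ->
    d (gamma s) (gamma t) = (`|t - s|%:E * d y y')%E /\
    (`|t - s|%:E * d y y' < +oo)%E].

Definition complete_geodesic : Prop := complete_dist /\ geodesic_dist.

End CompleteGeodesic.

(** The library's [completeType] is pointed, which would exclude an empty [X]. *)
Definition complete_metric (R : realType) (X : metricType R) : Prop :=
  complete_dist [set: X] (fun x y => (mdist x y)%:E).

(* Main.v *)
Require Import Defs.
From mathcomp Require Import all_boot all_order all_algebra.
From mathcomp Require Import all_classical all_reals all_analysis.
From mathcomp Require Import measurable_realfun lra.

(** Let [lip_joined Y L a b] mean that a 1-Lipschitz curve [0, L] -> Y goes from
    [a] to [b]. Then [d_Y a b <= L] iff [lip_joined Y L a b], and everything
    follows: concatenating and restricting Lipschitz curves shows that a curve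
    realizing [d_Y y y'] is a geodesic, and completeness is lower
    semicontinuity of [d_Y] under sigma-convergence of an endpoint.

    Compactness: if 1-Lipschitz curves of length [L + 1/(n+1)] join [a] to
    [b n] and [b n] sigma-converges to [b], a diagonal extraction makes them
    sigma-converge at all rational times. At any other time [t] take a
    sigma-limit along some further subsequence, depending on [t]; lower
    semicontinuity of [d_X] against the rational times makes the limit curve
    1-Lipschitz, and sigma-closedness keeps it in [Y].

    Reparametrization: let [gamma] be absolutely continuous with integrable
    modulus [w] and length less than [l]. For small [e] let [F_k] be the set of
    times near which [gamma] is not [(k+1)e]-Lipschitz as seen from that time;
    it is Borel and the metric derivative is at least [(k+1)e] on it. With open
    sets [V_k] slightly larger than [F_k] and [N] large, the function
    [u = e + sum_(k < N) e 1_(V_k) + w 1_(V_N)] has integral at most [l], and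
    every time [t] has a neighbourhood in which [d_X (gamma s) (gamma t)] is at
    most the integral of [u] between [s] and [t]. By a supremum argument this
    holds for all [s <= t], so [gamma] factors through the primitive of [u] as
    a 1-Lipschitz curve. *)

Set Implicit Arguments.
Unset Strict Implicit.
Unset Printing Implicit Defensive.
Import Order.TTheory GRing.Theory Num.Theory.
Import numFieldNormedType.Exports.

Local Open Scope classical_set_scope.
Local Open Scope ring_scope.

(** * Lipschitz curves *)

Section LipschitzCurves.
Context (R : realType) (X : metricType R) (Y : set X).

(** For [L < 0] the last two clauses are vacuous, hence the hypotheses [0 <= L] below. *)
Definition lip_joined (L : R) (a b : X) : Prop :=
  exists c : R -> X,
  [/\ c 0 = a, c L = b, forall t, 0 <= t <= L -> Y (c t) &
    forall s t, 0 <= s -> s <= t -> t <= L -> mdist (c s) (c t) <= t - s].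

Lemma lip_joined_sub (L : R) (c : R -> X) (s t : R) :
  (forall t, 0 <= t <= L -> Y (c t)) ->
  (forall s t, 0 <= s -> s <= t -> t <= L -> mdist (c s) (c t) <= t - s) ->
  0 <= s -> s <= t -> t <= L -> lip_joined (t - s) (c s) (c t).
Proof.
move=> Yc lipc s0 st tL; exists (fun r => c (s + r)).
split=> [||r /andP[r0 rts]|r r' r0 rr' r'ts]; rewrite ?addr0 ?subrKC//.
- by apply: Yc; lra.
- by rewrite (le_trans (lipc _ _ _ _ _))//; lra.
Qed.

Lemma lip_joined_sym (L : R) (a b : X) : lip_joined L a b -> lip_joined L b a.
Proof.
move=> [c [c0 cL Yc lipc]]; exists (fun r => c (L - r)).
split=> [||r rL|r r' r0 rr' r'L]; rewrite ?subr0 ?subrr//.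
- by apply: Yc; lra.
- by rewrite metric_sym (le_trans (lipc _ _ _ _ _))//; lra.
Qed.

Lemma lip_joined_trans (L M : R) (a b x : X) : 0 <= L -> 0 <= M ->
  lip_joined L a b -> lip_joined M b x -> lip_joined (L + M) a x.
Proof.
move=> L0 M0 [c [c0 cL Yc lipc]] [c' [c'0 c'M Yc' lipc']].
exists (fun r => if r <= L then c r else c' (r - L)).
split=> [||r rL|s t s0 st tL].
- by rewrite L0.
(* The endpoint [L + M] falls in the first branch only if [M = 0], and then
   [c L = b = c' 0 = c' M]. *)
- case: ifPn => [LML|_]; last by rewrite addrC addKr.
  have M_0 : M = 0 by lra.
  by rewrite M_0 addr0 cL -c'0 -[in RHS]c'M M_0.
- by case: ifPn => rL'; [apply: Yc|apply: Yc']; lra.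
- have [sL|Ls] := leP s L; have [tL'|Lt] := leP t L.
  + exact: lipc.
  + rewrite (le_trans (metric_triangle _ b _))//.
    have := lipc s L s0 sL (lexx _).
    have : mdist (c' 0) (c' (t - L)) <= t - L - 0 by apply: lipc'; lra.
    rewrite cL c'0; lra.
  + lra.
  + by rewrite (le_trans (lipc' _ _ _ _ _))//; lra.
Qed.

(** The speed is only bounded by 1, so the curve may wait at [b] for the remaining time [M - L]. *)
Lemma lip_joined_le (L M : R) (a b : X) : 0 <= L -> L <= M ->
  lip_joined L a b -> lip_joined M a b.
Proof.
move=> L0 LM [c [c0 cL Yc lipc]].
have -> : M = L + (M - L) by lra.
apply: (@lip_joined_trans _ _ a b b) => //; first lra.
  by exists c.
exists (fun=> b); split=> // [t tM|s t _ st _]; first by rewrite -cL; apply: Yc; lra.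
by rewrite mdistxx; lra.
Qed.

End LipschitzCurves.

(** * Metric derivative and length distance *)

Section MetricDerivative.
Context (R : realType) (X : metricType R).
Notation mu := (@lebesgue_measure R).

Lemma metric_derivative_ge (gamma : R -> X) (t c : R) :
  (forall e : R, 0 < e -> exists s, [/\ 0 <= s <= 1, s != t, `|s - t| < e &
    c <= mdist (gamma s) (gamma t) / `|s - t|]) ->
  (c%:E <= metric_derivative gamma t)%E.
Proof.
move=> H; apply: le_ereal_inf_tmp => _ [V] /nbhs_ballP[e /= e0 eV] <-.
have [s [s01 st ste cs]] := H _ e0.
apply: le_ereal_sup_tmp; exists ((mdist (gamma s) (gamma t) / `|s - t|)%:E); last first.
  by rewrite lee_fin.
exists s => //; apply: eV => //=.
by rewrite /ball/= distrC.
Qed.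

(** The quotients are nonnegative, but a supremum over the empty set would be [-oo]: every
    neighbourhood of [t] must contain another point of [0, 1]. It is taken to the right of [t] if
    [t <= 1 / 2], to the left otherwise. *)
Lemma metric_derivative_ge0 (gamma : R -> X) (t : R) : 0 <= t <= 1 ->
  (0 <= metric_derivative gamma t)%E.
Proof.
move=> t01; apply: metric_derivative_ge => e e0.
have [t2|t2] := leP t (1 / 2).
  exists (t + Num.min (e / 2) (1 / 2)).
  have m0 : 0 < Num.min (e / 2) (1 / 2) by rewrite lt_min; lra.
  have me : Num.min (e / 2) (1 / 2) <= e / 2 by rewrite ge_min lexx.
  have m1 : Num.min (e / 2) (1 / 2) <= 1 / 2 by rewrite ge_min lexx orbT.
  move: (Num.min _ _) m0 me m1 => m m0 me m1.
  rewrite addrAC subrr add0r gtr0_norm//; split => //; try lra.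
  by rewrite divr_ge0 ?mdist_ge0// ltW.
exists (t - Num.min (e / 2) (1 / 2)).
have m0 : 0 < Num.min (e / 2) (1 / 2) by rewrite lt_min; lra.
have me : Num.min (e / 2) (1 / 2) <= e / 2 by rewrite ge_min lexx.
have m1 : Num.min (e / 2) (1 / 2) <= 1 / 2 by rewrite ge_min lexx orbT.
move: (Num.min _ _) m0 me m1 => m m0 me m1.
rewrite addrAC subrr add0r normrN gtr0_norm//; split => //; try lra.
by rewrite divr_ge0 ?mdist_ge0// ltW.
Qed.

Lemma metric_derivative_le (gamma : R -> X) (t c : R) :
  (forall s, 0 <= s <= 1 -> mdist (gamma s) (gamma t) <= c * `|s - t|) ->
  (metric_derivative gamma t <= c%:E)%E.
Proof.
move=> H; apply: ge_ereal_inf.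
exists (ereal_sup ((fun s => (mdist (gamma s) (gamma t) / `|s - t|)%:E) @`
    [set s | 0 <= s <= 1 /\ s != t])).
  eexists; last by [].
  by apply/nbhs_ballP; exists 1 => //= s _ st; rewrite in_itv.
apply: ge_ereal_sup => _ [s [s01 st] <-].
by rewrite lee_fin ler_pdivrMr ?normr_gt0 ?subr_eq0// H.
Qed.

(* [metric_derivative] is not known to be measurable, but the integral of a
   nonnegative function is a supremum over the simple functions below it. *)
Lemma ge0_le_integral_nomeas (D : set R) (f g : R -> \bar R) :
  (forall x, D x -> 0 <= f x)%E ->
  (forall x, D x -> f x <= g x)%E ->
  (\int[mu]_(x in D) f x <= \int[mu]_(x in D) g x)%E.
Proof.
move=> f0 fg; have g0 x : D x -> (0 <= g x)%E.
  by move=> Dx; rewrite (le_trans (f0 _ Dx))// fg.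
rewrite !ge0_integralE//; apply: ereal_sup_le => _ [h hf <-]; exists h => // x.
rewrite (le_trans (hf x))// /patch; case: ifPn => // /set_mem; exact: fg.
Qed.

Lemma curve_length_ge0 (gamma : R -> X) : (0 <= curve_length gamma)%E.
Proof.
apply: integral_ge0 => t /=; rewrite in_itv/=; exact: metric_derivative_ge0.
Qed.

Lemma length_dist_ge0 (Y : set X) (a b : X) : (0 <= length_dist Y a b)%E.
Proof. by apply: le_ereal_inf_tmp => _ [g _ <-]; exact: curve_length_ge0. Qed.

(** Rescaled to [0, 1], the curve is [L]-Lipschitz, so the constant [L] serves both as modulus and
    as bound on the metric derivative. *)
Lemma length_dist_le (Y : set X) (L : R) (a b : X) : 0 <= L ->
  lip_joined Y L a b -> (length_dist Y a b <= L%:E)%E.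
Proof.
move=> L0 [c [c0 cL Yc lipc]]; pose g t := c (t * L).
have lipg s t : 0 <= s -> s <= t -> t <= 1 -> mdist (g s) (g t) <= L * (t - s).
  move=> s0 st t1; rewrite (le_trans (lipc _ _ _ _ _))//; last by nra.
  - exact: mulr_ge0.
  - exact: ler_wpM2r.
  - by rewrite ler_piMl.
have intL s t : s < t -> (\int[mu]_(x in `[s, t]) L%:E)%E = (L * (t - s))%:E.
  by move=> st; rewrite (integral_cst mu _ L%:E)//= lebesgue_measure_itv/= lte_fin st
    -EFinD.
apply: ge_ereal_inf; exists (curve_length g).
  exists g => //; split; rewrite /g ?mul0r ?mul1r//; last first.
    move=> t t01; apply: Yc; apply/andP; split; first by apply: mulr_ge0; lra.
    by rewrite ler_piMl//; lra.
  exists (cst L) => [|s t s0 st t1].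
    apply: measurable_bounded_integrable => //=.
      by rewrite lebesgue_measure_itv/= lte_fin ltr01 oppr0 adde0 ltry.
    by exists L; split; [exact: num_real|move=> M LM t _; rewrite /= ger0_norm// ltW].
  by rewrite intL// lee_fin; apply: lipg => //; exact: ltW.
have -> : L%:E = (\int[mu]_(t in `[0%R, 1%R]) L%:E)%E.
  by rewrite intL// subr0 mulr1.
apply: ge0_le_integral_nomeas => t /=; rewrite in_itv/= => /andP[t0 t1].
  by apply: metric_derivative_ge0; lra.
apply: metric_derivative_le => s /andP[s0 s1].
have [st|ts] := leP s t.
  by rewrite distrC ger0_norm ?subr_ge0// lipg.
by rewrite metric_sym gtr0_norm ?subr_gt0// lipg// ltW.
Qed.

End MetricDerivative.

(** * Sigma-limits *)

Section SigmaLimits.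
Context (R : realType) (X : metricType R) (sigma : topology_on X).

Lemma seq_cvg_for_cst (x : X) : seq_cvg_for sigma (fun=> x) x.
Proof. exact: cvg_cst. Qed.

Lemma seq_cvg_for_subseq (u v : nat -> X) (x : X) :
  (forall M, exists N, forall n, (N <= n)%N -> exists2 r, (M <= r)%N & v n = u r) ->
  seq_cvg_for sigma u x -> seq_cvg_for sigma v x.
Proof.
move=> uv ux A /ux[M _ MA]; have [N NP] := uv M.
by exists N => // n /= /NP[r Mr ->]; exact: MA.
Qed.

Lemma seq_cvg_for_closed (Y : set X) (u : nat -> X) (x : X) :
  closed_for sigma Y -> (forall n, Y (u n)) -> seq_cvg_for sigma u x -> Y x.
Proof.
move=> cY Yu ux; apply: (@closed_cvg _ _ _ eventually_filter
  (u : nat -> retopologize sigma) Y) ux => //.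
by exists 0%N.
Qed.

(** The lower limit is a supremum of infima over sets containing a tail, and each such set contains
    an index beyond [N]. *)
Lemma mdist_lsc_le (u v : nat -> X) (x y : X) (B : R) :
  mdist_seq_lsc sigma -> seq_cvg_for sigma u x -> seq_cvg_for sigma v y ->
  (forall e : R, 0 < e -> exists N, forall n, (N <= n)%N ->
    mdist (u n) (v n) <= B + e) ->
  mdist x y <= B.
Proof.
move=> lsc ux vy uvB; apply/ler_addgt0Pr => e e0.
have [N NB] := uvB e e0.
rewrite -lee_fin; apply: le_trans (lsc _ _ _ _ ux vy) _.
rewrite -[limn_einf _]/(limf_einf _ _) limf_einfE.
apply: ge_ereal_sup => _ [A [M _ MA] <-].
apply: ge_ereal_inf; exists (mdist (u (maxn N M)) (v (maxn N M)))%:E.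
  by exists (maxn N M) => //; apply: MA; rewrite /= leq_maxr.
by rewrite lee_fin NB// leq_maxl.
Qed.

End SigmaLimits.

Lemma homo_ltn_ge_id (f : nat -> nat) :
  {homo f : m n / (m < n)%N} -> forall n, (n <= f n)%N.
Proof. by move=> hf; elim=> // n IH; exact: leq_ltn_trans IH (hf _ _ (ltnSn _)). Qed.

(* The second hypothesis says that [P k] passes to any [v] that is, beyond rank
   [k], a subsequence of [u]; the diagonal is such a [v] for each [k]. *)
Lemma diagonal_extraction (T : Type) (P : nat -> (nat -> T) -> Prop) :
  (forall k (u : nat -> T), exists2 phi, {homo phi : m n / (m < n)%N} & P k (u \o phi)) ->
  (forall k (u v : nat -> T), (forall n, (k < n)%N ->
     exists2 r, (n <= r)%N & v n = u r) -> P k u -> P k v) ->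
  forall u : nat -> T, exists2 D : nat -> nat,
    (forall n, (n <= D n)%N) & forall k, P k (u \o D).
Proof.
move=> ex sub u.
have /choice[phi phiP] (kf : nat * (nat -> nat)) : exists phi : nat -> nat,
    {homo phi : m n / (m < n)%N} /\ P kf.1 (u \o kf.2 \o phi).
  by have [phi] := ex kf.1 (u \o kf.2); exists phi.
(* [Phi k] composes the first [k] extractions; the diagonal is [n |-> Phi n n]. *)
pose Phi := fix Phi k := if k is k'.+1 then Phi k' \o phi (k', Phi k') else id.
have PhiD k j : exists2 theta : nat -> nat, (forall n, (n <= theta n)%N) &
    Phi (j + k)%N =1 Phi k \o theta.
  elim: j => [|j [theta tn tE]]; first by exists id.
  exists (theta \o phi (j + k, Phi (j + k))%N) => n /=; last by rewrite tE.
  exact: leq_trans (homo_ltn_ge_id (phiP _).1 n) (tn _).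
exists (fun n => Phi n n) => [n|k].
  have [theta tn] := PhiD 0 n; rewrite addn0 => -> /=; exact: tn.
(* [P k] is gained at extraction number [k], hence holds from [Phi k.+1] on; for [n > k], [Phi n]
   factors through [Phi k.+1]. *)
apply: (sub _ (u \o Phi k.+1)) => [n kn|]; last first.
  by have [_] := phiP (k, Phi k).
have [theta tn tE] := PhiD k.+1 (n - k.+1)%N.
exists (theta n) => //=; congr u.
by rewrite -[RHS]tE subnK.
Qed.

(** * Reparametrization of absolutely continuous curves *)

Section SlopeSets.
Context (R : realType) (X : metricType R) (gamma : R -> X).
Notation mu := (@lebesgue_measure R).

Definition slope_le (c : R) : set R :=
  [set t | 0 <= t <= 1 /\ exists2 e : R, 0 < e &
    forall s : R, 0 <= s <= 1 -> `|s - t| < e ->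
    mdist (gamma s) (gamma t) <= c * `|s - t|].

Lemma metric_derivative_slope (c t : R) : 0 <= t <= 1 -> ~ slope_le c t ->
  (c%:E <= metric_derivative gamma t)%E.
Proof.
move=> t01 ct; apply: metric_derivative_ge => e e0; apply: contrapT => nH.
apply: ct; split => //; exists e => // s s01 ste.
rewrite leNgt; apply/negP => cs; apply: nH; exists s.
have st : s != t.
  by apply: contraPneq cs => ->; rewrite mdistxx subrr normr0 mulr0 ltxx.
by split => //; rewrite ler_pdivlMr ?normr_gt0 ?subr_eq0// ltW.
Qed.

Hypothesis gamma_unif : forall e : R, 0 < e -> exists2 d : R, 0 < d &
  forall s t : R, 0 <= s <= 1 -> 0 <= t <= 1 -> `|s - t| < d ->
  mdist (gamma s) (gamma t) < e.

(** The set is a countable union, over the radii [1/(n+1)], of sets that are closed because [gamma]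
    is continuous and the radius condition is strict. *)
Lemma measurable_slope_le (c : R) : 0 <= c -> measurable (slope_le c).
Proof.
move=> c0; pose A n := [set t : R | 0 <= t <= 1 /\
    forall s : R, 0 <= s <= 1 -> `|s - t| < n.+1%:R^-1 ->
    mdist (gamma s) (gamma t) <= c * `|s - t|].
suff -> : slope_le c = \bigcup_n A n.
  apply: bigcupT_measurable => n; apply: closed_measurable => t clt.
  have t01 : 0 <= t <= 1.
    have : closure (`[0, 1]%classic : set R) t.
      by apply: closure_subset clt => x [x01 _]; rewrite /= in_itv.
    by rewrite -(closure_id _).1 /= ?in_itv//; exact: interval_closed.
  split=> // s s01 st; apply/ler_addgt0Pr => e e0.
  have e20 : 0 < e / 2 by lra.
  have [d d0 dP] := gamma_unif e20.
  (* For [x] within [r] of [t]: the first bound puts [gamma x] within [e / 2] of [gamma t], the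
     second keeps [s] within the radius around [x], the third makes [c * |t - x|] less than
     [e / 2]. *)
  pose r := Num.min (Num.min d (n.+1%:R^-1 - `|s - t|)) (e / 2 / (c + 1)).
  have r0 : 0 < r.
    by rewrite !lt_min d0 subr_gt0 st divr_gt0//; lra.
  have [x [[x01 Ax]]] := clt _ (nbhsx_ballx t r r0).
  rewrite /ball/= !lt_min => /andP[/andP[txd txn] txe].
  have sx : `|s - x| <= `|s - t| + `|t - x| by exact: ler_distD.
  have := metric_triangle (gamma s) (gamma x) (gamma t).
  have := Ax s s01 (le_lt_trans sx _); rewrite -ltrBrDl => /(_ txn).
  have := dP x t x01 t01; rewrite distrC => /(_ txd).
  move: txe; rewrite ltr_pdivlMr; last lra.
  have := normr_ge0 (t - x).
  move: sx => /(ler_wpM2l c0); nra.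
apply/seteqP; split => t.
  move=> [t01 [e e0 He]]; have [n ne] : exists n : nat, n.+1%:R^-1 < e.
    exists (Num.truncn e^-1); rewrite invf_plt ?posrE//.
    exact: truncnS_gt.
  by exists n => //; split=> // s s01 sn; apply: He => //; exact: lt_trans ne.
by move=> [n _ [t01 At]]; split => //; exists n.+1%:R^-1 => //; rewrite invr_gt0.
Qed.

End SlopeSets.

(** Let [c] be the supremum of the times up to [t] at which the bound from [s] holds. The local
    estimate to the left of [c] shows that it holds at [c]; the one to the right shows that it holds
    beyond [c] unless [c = t]. *)
Lemma local_to_global (R : realType) (X : metricType R) (gamma : R -> X)
    (U : R -> R) :
  (forall t : R, 0 <= t <= 1 -> exists2 e : R, 0 < e &
    forall a b : R, 0 <= a -> a <= b -> b <= 1 -> a = t \/ b = t -> b - a < e ->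
    mdist (gamma a) (gamma b) <= U b - U a) ->
  forall s t : R, 0 <= s -> s <= t -> t <= 1 ->
  mdist (gamma s) (gamma t) <= U t - U s.
Proof.
move=> loc s t s0 st t1.
pose S := [set x : R | s <= x <= t /\ mdist (gamma s) (gamma x) <= U x - U s].
have Ss : S s by rewrite /S/= lexx st mdistxx subrr.
have supS : has_sup S.
  by split; [exists s|exists t => x [/andP[]]].
have sc : s <= sup S by exact: ub_le_sup supS.2 _ Ss.
have ct : sup S <= t by apply: ge_sup; [exists s|move=> x [/andP[]]].
have adh (e : R) : 0 < e -> exists2 x, S x & sup S - e < x.
  by move=> e0; exact: sup_adherent.
move: (sup S) sc ct adh (ub_le_sup supS.2).
move=> c sc ct adh ubc.
have [|e e0 He] := loc c; first lra.
have [x [/andP[sx xt] dx] cx] := adh _ e0.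
have xc : x <= c by apply: ubc; split => //; rewrite sx.
have Sc : mdist (gamma s) (gamma c) <= U c - U s.
  rewrite (le_trans (metric_triangle _ (gamma x) _))//.
  have : mdist (gamma x) (gamma c) <= U c - U x by apply: He; [lra..|right|lra].
  lra.
have [ct'|] := ltP c t; last first.
  by move=> tc; have -> : t = c by lra.
pose y := Num.min (c + e / 2) t.
have cy : c < y by rewrite lt_min ct' andbT; lra.
have ye : y <= c + e / 2 by rewrite ge_min lexx.
have yt : y <= t by rewrite ge_min lexx orbT.
suff : S y by move=> /ubc; lra.
split; first lra.
rewrite (le_trans (metric_triangle _ (gamma c) _))//.
have : mdist (gamma c) (gamma y) <= U y - U c by apply: He; [lra..|left|lra].
lra.
Qed.

(** By the intermediate value theorem [U - U 0] has a right inverse [tau]. [U] need not be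
    injective, but [gamma] agrees at times with equal [U], so the choice of [tau] does not affect
    [gamma \o tau]. *)
Lemma lip_joined_reparam (R : realType) (X : metricType R) (Y : set X)
    (gamma : R -> X) (U : R -> R) :
  (forall t : R, 0 <= t <= 1 -> Y (gamma t)) ->
  {within `[0, 1], continuous U} ->
  (forall s t : R, 0 <= s -> s <= t -> t <= 1 ->
    mdist (gamma s) (gamma t) <= U t - U s) ->
  lip_joined Y (U 1 - U 0) (gamma 0) (gamma 1).
Proof.
move=> Yg cU gU.
have U01 : U 0 <= U 1.
  by rewrite -subr_ge0 (le_trans _ (gU 0 1 _ _ _))// mdist_ge0.
have /choice[tau tauP] v : exists t : R, 0 <= v <= U 1 - U 0 ->
    0 <= t <= 1 /\ U t = U 0 + v.
  have [v01|nv] := pselect (0 <= v <= U 1 - U 0); last by exists 0.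
  have [|t t01 Ut] := @IVT R U 0 1 (U 0 + v) ler01 cU.
    by rewrite min_l// max_r//; lra.
  by exists t => _; split => //; move: t01; rewrite in_itv.
have dU s t : 0 <= s <= 1 -> 0 <= t <= 1 ->
    mdist (gamma s) (gamma t) <= `|U t - U s|.
  move=> s01 t01; have [st|ts] := leP s t.
    by rewrite (le_trans _ (ler_norm _))// gU//; lra.
  by rewrite metric_sym distrC (le_trans _ (ler_norm _))// gU//; lra.
have d0 s t : 0 <= s <= 1 -> 0 <= t <= 1 -> U s = U t -> gamma s = gamma t.
  move=> s01 t01 Ust; apply: mdist_positivity; apply/eqP.
  by rewrite eq_le mdist_ge0 andbT (le_trans (dU _ _ _ _))// Ust subrr normr0.
exists (gamma \o tau); split => /=.
- by have [|t01 Ut] := tauP 0; [lra|apply: d0 => //; lra].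
- by have [|t01 Ut] := tauP (U 1 - U 0); [lra|apply: d0 => //; lra].
- by move=> t /tauP[? _]; exact: Yg.
- move=> s t s0 st tL; have [|s01 Us] := tauP s; first lra.
  have [|t01 Ut] := tauP t; first lra.
  rewrite (le_trans (dU _ _ _ _))// Us Ut ger0_norm; lra.
Qed.

(** * Integrable moduli of absolutely continuous curves *)

Section Majorant.
Context (R : realType) (X : metricType R).
Notation mu := (@lebesgue_measure R).

(** Taking [|m|] on [0, 1] and 0 elsewhere makes the modulus nonnegative and integrable on the whole
    line. *)
Lemma abs_continuous_Rintegral (gamma : R -> X) : abs_continuous gamma ->
  exists w : R -> R, [/\ forall x, 0 <= w x, mu.-integrable setT (EFin \o w) &
    forall s t : R, 0 <= s -> s <= t -> t <= 1 ->
    mdist (gamma s) (gamma t) <= \int[mu]_(u in `[s, t]) w u].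
Proof.
move=> [m mint mP]; pose w := (fun x => `|m x|) \_ `[0%R, 1%R].
have w0 x : 0 <= w x by rewrite /w /patch; case: ifP.
have intw : mu.-integrable setT (EFin \o w).
  rewrite -restrict_EFin; apply/integrable_restrict => //=; rewrite setTI.
  exact: integrable_norm.
exists w; split => // s t s0 st t1.
have [<-|nst] := eqVneq s t; first by rewrite mdistxx Rintegral_ge0.
have st' : s < t by rewrite lt_neqAle nst.
have st01 : `[s, t] `<=` `[0%R, 1%R].
  by move=> x; rewrite /= !in_itv/=; lra.
have intS (f : R -> R) D : measurable D -> mu.-integrable setT (EFin \o f) ->
    mu.-integrable D (EFin \o f).
  by move=> mD; exact: integrableS.
rewrite -lee_fin (le_trans (mP _ _ s0 st' t1))//.
rewrite fineK; last by apply: integrable_fin_num => //; exact: intS.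
apply: le_integral => //; first exact: integrableS mint.
  exact: intS.
move=> x /set_mem xst; rewrite lee_fin /w /patch mem_set ?ler_norm//.
exact: st01.
Qed.

Variables (gamma : R -> X) (w : R -> R).
Hypothesis w_ge0 : forall x, 0 <= w x.
Hypothesis w_int : mu.-integrable setT (EFin \o w).
Hypothesis gamma_w : forall s t : R, 0 <= s -> s <= t -> t <= 1 ->
  mdist (gamma s) (gamma t) <= \int[mu]_(u in `[s, t]) w u.

Lemma unif_continuous_of_majorant (e : R) : 0 < e -> exists2 d : R, 0 < d &
  forall s t : R, 0 <= s <= 1 -> 0 <= t <= 1 -> `|s - t| < d ->
  mdist (gamma s) (gamma t) < e.
Proof.
move=> e0; have [d [d0 dP]] := integral_normr_continuous w_int e0.
exists d => // s t; wlog st : s t / s <= t.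
  by move=> H s01 t01; have [?|/ltW ?] := leP s t; [|rewrite metric_sym distrC];
     exact: H.
move=> s01 t01; rewrite distrC ger0_norm ?subr_ge0// => std.
have mst : (mu `[s, t] < d%:E)%E.
  rewrite lebesgue_measure_itv/= lte_fin; case: ifPn => _; last by rewrite lte_fin.
  by rewrite -EFinD lte_fin.
apply: le_lt_trans (dP _ (measurable_itv _) mst).
under eq_Rintegral do rewrite ger0_norm//.
by apply: gamma_w; lra.
Qed.

End Majorant.

(** * Local majorants with integral close to the length *)

Section MajorantExists.
Context (R : realType) (X : metricType R).
Notation mu := (@lebesgue_measure R).
Variables (gamma : R -> X) (w : R -> R).
Hypothesis w_ge0 : forall x, 0 <= w x.
Hypothesis w_int : mu.-integrable setT (EFin \o w).
Hypothesis gamma_w : forall s t : R, 0 <= s -> s <= t -> t <= 1 ->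
  mdist (gamma s) (gamma t) <= \int[mu]_(u in `[s, t]) w u.

Let I01 : set R := `[0%R, 1%R]%classic.

Let measurable_I01 : measurable I01.
Proof. exact: measurable_itv. Qed.

Let integral_cst_indic (A : set R) c : measurable A -> 0 <= c ->
  (\int[mu]_(x in I01) (c%:E * (\1_A x)%:E))%E = (c%:E * mu (A `&` I01))%E.
Proof.
move=> mA c0; rewrite ge0_integralZl//; last first.
  by apply/measurable_EFinP; exact: measurable_indic.
by rewrite integral_indic.
Qed.

(* The threshold is [k.+1 * e], not [k * e], so that the constant term [e] of the
   majorant accounts for the times lying in no [steep e k]. *)
Let steep (e : R) (k : nat) : set R := I01 `\` slope_le gamma (k.+1%:R * e).

Let measurable_steep e k : 0 < e -> measurable (steep e k).
Proof.
move=> e0; apply: measurableD; first exact: measurable_itv.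
apply: measurable_slope_le; last by rewrite mulr_ge0// ltW.
exact: unif_continuous_of_majorant w_ge0 w_int gamma_w.
Qed.

Let mu_steep_fin e k : 0 < e -> mu (steep e k) \is a fin_num.
Proof.
move=> e0; rewrite ge0_fin_numE//; apply: (@le_lt_trans _ _ (mu I01)).
  by apply: le_measure; rewrite ?inE; [exact: measurable_steep|
    exact: measurable_I01|exact: subDsetl].
by rewrite lebesgue_measure_itv/= lte_fin ltr01 -EFinD ltry.
Qed.

Let steep_derivative e k t : steep e k t ->
  ((k.+1%:R * e)%:E <= metric_derivative gamma t)%E.
Proof.
by move=> [t01 nt]; apply: metric_derivative_slope nt; move: t01; rewrite /I01/= in_itv.
Qed.

Let derivative_ge0 t : I01 t -> (0 <= metric_derivative gamma t)%E.
Proof. by rewrite /I01/= in_itv; exact: metric_derivative_ge0. Qed.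

Let integral_steep e k c : 0 < e -> 0 <= c ->
  (\int[mu]_(x in I01) (c%:E * (\1_(steep e k) x)%:E))%E =
  (c%:E * mu (steep e k))%E.
Proof.
move=> e0 c0; rewrite integral_cst_indic//; last exact: measurable_steep.
by congr (_ * mu _)%E; rewrite setIidl//; exact: subDsetl.
Qed.

Let markov_steep e k : 0 < e ->
  ((k.+1%:R * e)%:E * mu (steep e k) <= curve_length gamma)%E.
Proof.
move=> e0; rewrite -integral_steep//; last by rewrite mulr_ge0// ltW.
apply: ge0_le_integral_nomeas => t tI.
  by rewrite mule_ge0// lee_fin// mulr_ge0// ltW.
rewrite indicE; have [/set_mem /steep_derivative|_] := boolP (t \in _).
  by rewrite mule1.
by rewrite mule0 derivative_ge0.
Qed.

(** The integrands are compared pointwise by induction on [n]: for [t] in the last set, the [n.+1]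
    terms total at most [n.+1 * e], which is below the metric derivative; otherwise the last term
    vanishes. *)
Let layer_cake e n : 0 < e ->
  (\sum_(0 <= k < n) e%:E * mu (steep e k) <= curve_length gamma)%E.
Proof.
move=> e0.
have mi k : measurable_fun I01 (fun x : R => (\1_(steep e k) x)%:E).
  by apply/measurable_EFinP; apply: measurable_indic; exact: measurable_steep.
under eq_bigr do rewrite -integral_steep ?ltW//.
rewrite -ge0_integral_sum//; last first.
  by move=> k x _; rewrite mule_ge0// lee_fin// ltW.
  by move=> k; apply: measurable_funeM; exact: mi.
apply: ge0_le_integral_nomeas => t tI.
  by apply: sume_ge0 => k _; rewrite mule_ge0// lee_fin// ltW.
elim: n => [|n IH]; first by rewrite big_nil derivative_ge0.
have [tn|tn] := pselect (steep e n t); last first.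
  rewrite big_nat_recr//= [X in (_ + X)%E](_ : _ = 0%E) ?adde0//.
  by rewrite indicE memNset// mule0.
apply: le_trans (steep_derivative tn).
apply: (@le_trans _ _ (\sum_(0 <= k < n.+1) e%:E)%E).
  apply: lee_sum => k _; rewrite -EFinM lee_fin; apply: ler_piMr; first exact: ltW.
  by rewrite indicE; case: (_ \in _).
by rewrite sumEFin lee_fin sumr_const_nat subn0 mulr_natl.
Qed.

Lemma local_majorant (l : R) : (curve_length gamma < l%:E)%E ->
  exists u : R -> R, [/\ forall x, 0 <= u x, mu.-integrable `[0%R, 1%R] (EFin \o u),
    \int[mu]_(x in `[0, 1]) u x <= l &
    forall t : R, 0 <= t <= 1 -> exists2 e : R, 0 < e &
    forall a b : R, 0 <= a -> a <= b -> b <= 1 -> a = t \/ b = t -> b - a < e ->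
    mdist (gamma a) (gamma b) <= \int[mu]_(x in `[a, b]) u x].
Proof.
move=> gl; have g0 := curve_length_ge0 gamma.
have [r rE] : exists r : R, curve_length gamma = r%:E.
  exists (fine (curve_length gamma)); rewrite fineK// ge0_fin_numE//.
  by rewrite (lt_trans gl)// ltry.
have [r0 rl] : 0 <= r /\ r < l by move: g0 gl; rewrite rE lee_fin lte_fin.
(* Error budget: one [e] for the constant term, one for enlarging the steep sets, one for [w] on
   [V N]; the fourth is slack. *)
have [e e0 lE] : exists2 e : R, 0 < e & l = r + 4 * e.
  by exists ((l - r) / 4); lra.
have [d [d0 dP]] := integral_normr_continuous w_int e0.
(* By [markov_steep], [p N <= r / (N.+1 * e)], which this [N] makes less than [d / 2]. *)
pose N := Num.truncn (2 * r / (e * d)).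
have NP : 2 * r / (e * d) < N.+1%:R by exact: truncnS_gt.
pose p k := fine (mu (steep e k)).
have pE k : mu (steep e k) = (p k)%:E by rewrite fineK// mu_steep_fin.
have pN : p N < d / 2.
  have := markov_steep N e0; rewrite pE rE -EFinM lee_fin => Np.
  move: NP; rewrite ltr_pdivrMr ?mulr_gt0// => NP.
  have : 0 < N.+1%:R :> R by [].
  have pN0 : 0 <= p N by rewrite fine_ge0.
  move: N.+1%:R NP Np => M NP Np M0.
  rewrite ltNge; apply/negP => dp.
  have : M * e * (d / 2) <= M * e * p N by rewrite ler_wpM2l// mulr_ge0// ltW.
  nra.
(* The first bound gives [V N] measure below [d]; the second keeps the total excess [N * e * h] of
   the enlarged layers below [e]. *)
pose h := Num.min (d / 2) N.+1%:R^-1.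
have h0 : 0 < h by rewrite lt_min invr_gt0 ltr0n andbT; lra.
have /choice[V VP] k : exists V : set R,
    [/\ open V, steep e k `<=` V & (mu V <= (p k + h)%:E)%E].
  have [|V [oV FV Vh]] := lebesgue_regularity_outer (measurable_steep k e0) _ h0.
    by apply: le_lt_trans (ltry (p k)); rewrite -pE.
  exists V; split => //.
  have mS := measurable_steep k e0; have mV := open_measurable oV.
  have -> : mu V = (mu (V `\` steep e k) + mu (V `&` steep e k))%E.
    exact: measureDI.
  rewrite EFinD [leRHS]addeC; apply: leeD; first exact: ltW.
  rewrite -pE; apply: le_measure; rewrite ?inE.
  - exact: measurableI.
  - exact: mS.
  - exact: subIsetr.
have mV k : measurable (V k) by have [oV _ _] := VP k; exact: open_measurable.
pose u2 x := \sum_(0 <= k < N) e * \1_(V k) x.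
pose u3 := w \_ (V N).
pose u x := e + u2 x + u3 x.
have u20 x : 0 <= u2 x by apply: sumr_ge0 => k _; rewrite mulr_ge0// ltW.
have u30 x : 0 <= u3 x by rewrite /u3 /patch; case: ifP.
have u0 x : 0 <= u x by rewrite /u !addr_ge0// ltW.
have mw : measurable_fun setT w by move/integrableP : w_int => [/measurable_EFinP].
have m3 : measurable_fun setT u3.
  by apply/(measurable_restrictT w (mV N)); exact: measurable_funTS.
have m2 : measurable_fun setT u2.
  apply: measurable_sum => k; apply: measurable_funM; first exact: measurable_cst.
  by apply: measurable_indic; exact: mV.
have mu1 : measurable_fun setT u.
  by apply: measurable_funD => //; exact: measurable_funD.
have mE (f : R -> R) : measurable_fun setT f -> measurable_fun I01 (EFin \o f).
  by move=> mf; apply/measurable_EFinP; exact: measurable_funTS.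
have muI : mu I01 = 1%E.
  by rewrite lebesgue_measure_itv/= lte_fin ltr01 -EFinD subr0.
have int2 : (\int[mu]_(x in I01) (u2 x)%:E <= (r + e)%:E)%E.
  have -> : (\int[mu]_(x in I01) (u2 x)%:E =
      \int[mu]_(x in I01) \sum_(0 <= k < N) (e%:E * (\1_(V k) x)%:E))%E.
    by apply: eq_integral => x _; rewrite -sumEFin.
  rewrite ge0_integral_sum//; last first.
    by move=> k x _; rewrite mule_ge0// lee_fin// ltW.
    by move=> k; apply: measurable_funeM; apply: mE; exact: measurable_indic.
  apply: (@le_trans _ _ (\sum_(0 <= k < N) (e * p k + e * h)%:E)%E).
    apply: lee_sum => k _; have [_ _ Vk] := VP k.
    rewrite (integral_cst_indic (mV k) (ltW e0)) -mulrDr EFinM.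
     apply: lee_wpmul2l; first by rewrite lee_fin ltW.
    apply: le_trans Vk; apply: le_measure; rewrite ?inE.
    - by apply: measurableI; [exact: mV|exact: measurable_I01].
    - exact: mV.
    - exact: subIsetl.
  have := layer_cake N e0; rewrite rE.
  rewrite (eq_bigr (fun k => (e * p k)%:E)); last by move=> k _; rewrite pE.
  rewrite !sumEFin !lee_fin big_split/= => /lerD; apply.
  rewrite sumr_const_nat subn0 -mulrnAr; apply: ler_piMr; first exact: ltW.
  rewrite -mulr_natl (@le_trans _ _ (N%:R * N.+1%:R^-1))//.
    by rewrite ler_wpM2l// ge_min lexx orbT.
  by rewrite ler_pdivrMr// mul1r ler_nat.
have int3 : (\int[mu]_(x in I01) (u3 x)%:E <= e%:E)%E.
  have -> : (\int[mu]_(x in I01) (u3 x)%:E = \int[mu]_(x in I01 `&` V N) (w x)%:E)%E.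
    rewrite [RHS]integral_mkcondr; apply: eq_integral => x _.
    by rewrite restrict_EFin.
  have mIV : measurable (I01 `&` V N).
    by apply: measurableI; [exact: measurable_I01|exact: mV].
  rewrite -[leLHS]fineK; last first.
    by apply: integrable_fin_num => //; exact: integrableS w_int.
  rewrite lee_fin ltW//.
  have := dP (I01 `&` V N) mIV.
  rewrite /Rintegral; under eq_integral do rewrite ger0_norm//.
  apply; apply: (@le_lt_trans _ _ (mu (V N))).
    by apply: le_measure; rewrite ?inE; [exact: mIV|exact: mV|exact: subIsetr].
  have [_ _ /le_lt_trans] := VP N; apply; rewrite lte_fin.
  have : h <= d / 2 by rewrite ge_min lexx.
  lra.
have intu : (\int[mu]_(x in I01) (u x)%:E <= l%:E)%E.
  have -> : (\int[mu]_(x in I01) (u x)%:E =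
      \int[mu]_(x in I01) ((e + u2 x)%:E + (u3 x)%:E))%E.
    by apply: eq_integral => x _; rewrite -EFinD.
  rewrite ge0_integralD//=; last 4 first.
  - by move=> x _; rewrite lee_fin addr_ge0// ltW.
  - by apply: (mE (fun x => e + u2 x)); exact: measurable_funD.
  - by move=> x _; rewrite lee_fin.
  - exact: (mE u3).
  have -> : (\int[mu]_(x in I01) (e + u2 x)%:E =
      \int[mu]_(x in I01) (e%:E + (u2 x)%:E))%E by [].
  rewrite ge0_integralD//=; last 3 first.
  - by move=> x _; rewrite lee_fin ltW.
  - by move=> x _; rewrite lee_fin.
  - exact: (mE u2).
  have -> : (\int[mu]_(x in I01) e%:E)%E = e%:E.
    transitivity (e%:E * mu I01)%E; last by rewrite muI mule1.
    exact: (integral_cst mu measurable_I01 e%:E).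
  apply: (@le_trans _ _ (e%:E + (r + e)%:E + e%:E)%E).
    by rewrite !leeD.
  by rewrite -!EFinD lee_fin lE; lra.
have intu1 : mu.-integrable `[0%R, 1%R] (EFin \o u).
  apply/integrableP; split; first exact: mE.
  under eq_integral do rewrite gee0_abs ?lee_fin//.
  by apply: le_lt_trans intu _; rewrite ltry.
exists u; split => //.
  rewrite -lee_fin fineK//.
  exact: integrable_fin_num.
move=> t t01.
have intS (f : R -> R) a b : 0 <= a -> b <= 1 ->
    mu.-integrable `[0%R, 1%R] (EFin \o f) -> mu.-integrable `[a, b] (EFin \o f).
  move=> a0 b1; apply: integrableS; [exact: measurable_itv..|].
  by move=> x; rewrite /= !in_itv/=; lra.
(* If [t] avoids some [steep e k] with [k <= N], let [j] be the least such index. Near [t] the curve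
   has slope at most [j.+1 * e] as seen from [t], and [u] is at least that: [e] from the constant
   and [e] from each [V i] with [i < j]. *)
have [[k kN ntk]|all_steep] := pselect (exists2 k, (k <= N)%N & ~ steep e k t).
  have [j [jN ntj jmin]] : exists j, [/\ (j <= N)%N, ~ steep e j t &
      forall i, (i < j)%N -> steep e i t].
    have : exists i, `[< ~ steep e i t >] by exists k; exact/asboolP.
    move=> /ex_minnP[j /asboolP ntj jmin]; exists j; split => //.
      by apply: leq_trans kN; apply: jmin; exact/asboolP.
    move=> i ij; apply: contrapT => /asboolP /jmin; rewrite leqNgt ij//.
  have [_ [d1 d10 d1P]] : slope_le gamma (j.+1%:R * e) t.
    by apply: contrapT => nt; apply: ntj; split => //; rewrite /I01/= in_itv.
  have : nbhs t [set x | forall i : 'I_j, V i x].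
    apply: (@filter_forall R _ (fun i : 'I_j => V i) _ (nbhs_filter t)) => i.
    have [oV FV _] := VP i.
    exact: open_nbhs_nbhs (conj oV (FV _ (jmin _ (ltn_ord i)))).
  move=> /nbhs_ballP[d2 /= d20 d2P].
  exists (Num.min d1 d2); first by rewrite lt_min d10.
  move=> a b a0 ab b1 abt; rewrite lt_min => /andP[bad1 bad2].
  have dab : mdist (gamma a) (gamma b) <= j.+1%:R * e * (b - a).
    case: abt => ?; subst.
      rewrite metric_sym (le_trans (d1P _ _ _))// ?ger0_norm//; lra.
    rewrite (le_trans (d1P a _ _))// ?(distrC a) ?ger0_norm//; lra.
  apply: (le_trans dab).
  have -> : j.+1%:R * e * (b - a) = \int[mu]_(x in `[a, b]) (j.+1%:R * e).
    rewrite Rintegral_cst//= lebesgue_measure_itv/= lte_fin.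
    case: ltP => [_|ba]; first by rewrite -EFinD.
    have -> : a = b by lra.
    by rewrite subrr.
  apply: le_Rintegral => //; last 2 first.
  - exact: intS.
  - move=> x; rewrite /= in_itv/= => xab.
    rewrite -[leLHS]addr0 /u lerD//.
    rewrite -natr1 mulrDl mul1r addrC lerD2l /u2.
    rewrite (big_cat_nat (n := j))//= -[leLHS]addr0 lerD//; last first.
      by apply: sumr_ge0 => i _; rewrite mulr_ge0// ltW.
    rewrite -[in leLHS](subn0 j) mulr_natl -sumr_const_nat.
    apply: ler_sum_nat => i /andP[_ ij].
    rewrite indicE mem_set ?mulr1//.
    apply: (d2P x _ (Ordinal ij)); rewrite /ball/=.
    by rewrite ltr_norml; case: abt => ?; subst; lra.
  - apply: intS => //; apply: measurable_bounded_integrable => //.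
      by rewrite -[X in (X < _)%E]/(mu I01) muI ltry.
    exists (j.+1%:R * e); split; first exact: num_real.
    by move=> M jM x _ /=; rewrite ger0_norm; [exact: ltW|rewrite mulr_ge0// ltW].
(* Otherwise [t] lies in the open set [V N], on which [u >= w], and the original modulus
   suffices. *)
have tVN : V N t.
  have [_ FV _] := VP N; apply: FV; apply: contrapT => nt.
  by apply: all_steep; exists N.
have [oVN _ _] := VP N.
have /nbhs_ballP[d2 /= d20 d2P] := open_nbhs_nbhs (conj oVN tVN).
exists d2 => // a b a0 ab b1 abt bad2.
apply: le_trans (gamma_w a0 ab b1) _.
apply: le_Rintegral => //.
- by apply: intS => //; exact: integrableS w_int.
- exact: intS.
- move=> x; rewrite /= in_itv/= => xab.
  have Vx : V N x.
    apply: d2P; rewrite /ball/= ltr_norml; case: abt => ?; subst; lra.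
  rewrite /u /u3 /patch mem_set//; have := u20 x; lra.
Qed.

End MajorantExists.

(** * From curves of finite length to Lipschitz curves *)

Section CurveToLipschitz.
Context (R : realType) (X : metricType R) (Y : set X).
Notation mu := (@lebesgue_measure R).

Lemma lip_joined_of_curve (gamma : R -> X) (l : R) :
  abs_continuous gamma -> (forall t : R, 0 <= t <= 1 -> Y (gamma t)) ->
  (curve_length gamma < l%:E)%E -> lip_joined Y l (gamma 0) (gamma 1).
Proof.
move=> /abs_continuous_Rintegral[w [w0 intw gw]] Yg gl.
have [u [u0 intu ul loc]] := local_majorant w0 intw gw gl.
pose U t := parameterized_integral mu 0 t u.
have UB a b : 0 <= a -> a <= b -> b <= 1 ->
    U b - U a = \int[mu]_(x in `[a, b]) u x.
  move=> a0 ab b1.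
  have intS c : 0 <= c -> mu.-integrable `[c, b] (EFin \o u).
    move=> c0; apply: integrableS intu; [exact: measurable_itv..|].
    by move=> x; rewrite /= !in_itv/=; lra.
  rewrite /U /parameterized_integral Rintegral_itvB ?bnd_simp//; last exact: intS.
  rewrite Rintegral_itv_obnd_cbnd//.
  apply: integrableS (intS a a0); [exact: measurable_itv..|].
  exact: subset_itv_oc_cc.
have cU : {within `[0, 1], continuous U}.
  exact: parameterized_integral_continuous.
(* The integral of [u] may be less than [l]; the rest of the time is spent waiting. *)
apply: (@lip_joined_le _ _ _ (U 1 - U 0)).
- by rewrite UB// Rintegral_ge0.
- by rewrite UB.
- apply: lip_joined_reparam => //.
  apply: local_to_global => t /loc[e e0 He]; exists e => // a b a0 ab b1 abt abe.
  by rewrite UB// He.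
Qed.

Lemma length_dist_lt_lip_joined (l : R) (a b : X) :
  (length_dist Y a b < l%:E)%E -> lip_joined Y l a b.
Proof.
move=> /ereal_inf_lt[_ [g [acg Yg <- <-] <-]] gl.
exact: lip_joined_of_curve.
Qed.

End CurveToLipschitz.

(** * Compactness and the theorem *)

Section Compactness.
Context (R : realType) (X : metricType R) (Y : set X) (sigma : topology_on X).
Hypothesis sigma_compact : forall B : set X,
  metric_bounded B -> relatively_seq_compact sigma B.
Hypothesis sigma_lsc : mdist_seq_lsc sigma.
Hypothesis Y_closed : closed_for sigma Y.

Let metric_bounded_ball (a : X) (r : R) : metric_bounded [set x | mdist a x <= r].
Proof.
exists (r + r) => x y /= ax ay.
by rewrite (le_trans (metric_triangle _ a _))// lerD// metric_sym.
Qed.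

Lemma lip_joined_lim (L : R) (a : X) (b : nat -> X) (b0 : X) : 0 <= L ->
  (forall n, lip_joined Y (L + n.+1%:R^-1) a (b n)) ->
  seq_cvg_for sigma b b0 -> lip_joined Y L a b0.
Proof.
move=> L0 /choice[c cP] bb0.
(* Clipping to [0, L] lets all real and rational times be used without side conditions. *)
pose clip (t : R) := Num.max 0 (Num.min t L).
have clip01 t : 0 <= clip t <= L by rewrite /clip le_max lexx ge_max L0 ge_min lexx orbT.
have clip_id t : 0 <= t <= L -> clip t = t.
  by move=> /andP[t0 tL]; rewrite /clip min_l// max_r.
have n0 n : 0 < n.+1%:R^-1 :> R by rewrite invr_gt0.
have leLn n : L <= L + n.+1%:R^-1 by rewrite lerDl ltW.
have lipc n s t : 0 <= s <= L -> 0 <= t <= L -> mdist (c n s) (c n t) <= `|s - t|.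
  have [_ _ _ lip] := cP n.
  wlog st : s t / s <= t.
    by move=> H ? ?; have [?|/ltW ?] := leP s t; [|rewrite metric_sym distrC];
       exact: H.
  move=> s01 t01; rewrite distrC ger0_norm ?subr_ge0//; apply: lip => //; first lra.
  by apply: le_trans (leLn n); lra.
have cB n t : 0 <= t <= L -> [set x | mdist a x <= L] (c n t).
  move=> t01 /=; have [<- _ _ _] := cP n.
  rewrite (le_trans (lipc n 0 t _ _)) ?lexx ?L0// sub0r normrN ger0_norm; lra.
(* An enumeration of the clipped rationals, with 0 for codes of no rational. *)
pose q k := clip (ratr (odflt 0 (unpickle k : option rat))).
have [||D Dn DP] := @diagonal_extraction nat
    (fun k v => exists x, seq_cvg_for sigma (fun n => c (v n) (q k)) x) _ _ id.
- move=> k u.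
  have [n|phi hphi [x xP]] := sigma_compact (metric_bounded_ball a L)
    (u := fun n => c (u n) (q k)); first by apply: cB; exact: clip01.
  by exists phi => //; exists x.
- move=> k u v uv [x ux]; exists x; apply: seq_cvg_for_subseq ux => M.
  exists (maxn k.+1 M) => n; rewrite geq_max => /andP[kn Mn].
  by have [r nr ->] := uv n kn; exists r => //; exact: leq_trans nr.
have /choice[xq xqP] := DP.
have /choice[g gP] t : exists x, exists2 phi : nat -> nat,
    {homo phi : m n / (m < n)%N} &
    seq_cvg_for sigma (fun n => c (D (phi n)) (clip t)) x.
  have [n|phi hphi [x xP]] := sigma_compact (metric_bounded_ball a L)
    (u := fun n => c (D n) (clip t)); first by apply: cB; exact: clip01.
  by exists x, phi.
(* [g s] and [g t] may be limits along different subsequences of [D], so each is compared with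
   [xq k], a limit along all of them. *)
have gq t k : mdist (g t) (xq k) <= `|clip t - q k|.
  have [phi hphi gt] := gP t.
  apply: (mdist_lsc_le sigma_lsc gt (v := fun n => c (D (phi n)) (q k))).
    apply: seq_cvg_for_subseq (xqP k) => M; exists M => n Mn.
    by exists (phi n) => //; rewrite (leq_trans Mn)// homo_ltn_ge_id.
  move=> e e0; exists 0%N => n _.
  by rewrite (le_trans (lipc _ _ _ (clip01 _) (clip01 _)))// lerDl ltW.
exists g; split.
- apply: mdist_positivity; apply/eqP; rewrite eq_le mdist_ge0 andbT.
  have [phi hphi g0] := gP 0.
  apply: (mdist_lsc_le sigma_lsc g0 (v := fun=> a)).
    exact: seq_cvg_for_cst.
  move=> e e0; exists 0%N => n _; rewrite clip_id ?lexx//.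
  by have [-> _ _ _] := cP (D (phi n)); rewrite mdistxx add0r ltW.
- apply: mdist_positivity; apply/eqP; rewrite eq_le mdist_ge0 andbT.
  have [phi hphi gL] := gP L.
  apply: (mdist_lsc_le sigma_lsc gL (v := fun n => b (D (phi n)))).
    apply: seq_cvg_for_subseq bb0 => M; exists M => n Mn.
    exists (D (phi n)) => //; rewrite (leq_trans Mn)// (leq_trans _ (Dn _))//.
    exact: homo_ltn_ge_id.
  (* At time [L] the curve numbered [m] is within [1/(m+1)] of its endpoint [b m]. *)
  move=> e e0; exists (Num.truncn e^-1) => n en.
  rewrite clip_id ?lexx ?L0//.
  have [_ <- _ lip] := cP (D (phi n)).
  rewrite (le_trans (lip _ _ L0 (leLn _) (lexx _)))// addrAC subrr !add0r.
  rewrite invf_ple ?posrE// (le_trans (ltW (truncnS_gt _)))// ler_nat ltnS.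
  by rewrite (leq_trans en)// (leq_trans _ (Dn _))// homo_ltn_ge_id.
- move=> t t01; have [phi _ gt] := gP t.
  apply: seq_cvg_for_closed Y_closed _ gt => n.
  have [_ _ Yc _] := cP (D (phi n)).
  by have /andP[ct0 ctL] := clip01 t; apply: Yc; rewrite ct0 (le_trans ctL).
- move=> s t s0; rewrite le_eqVlt => /predU1P[<- _|st tL].
    by rewrite mdistxx subrr.
  (* With [r] between [s] and [t], the two bounds [r - s] and [t - r] add up to exactly [t - s]. *)
  have [r] := rat_in_itvoo st; rewrite in_itv/= => /andP[sr rt].
  rewrite (le_trans (metric_triangle _ (xq (pickle r)) _))//.
  have := gq s (pickle r); have := gq t (pickle r).
  rewrite /q pickleK /= !clip_id; [|lra..].
  rewrite ger0_norm; last lra.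
  rewrite ltr0_norm; last lra.
  rewrite (metric_sym (g t)); lra.
Qed.

(** The constant sequence of endpoints turns nearly optimal curves into one of length [L]: the
    infimum is attained. *)
Lemma length_dist_lip_joined (L : R) (a b : X) : 0 <= L ->
  (length_dist Y a b <= L%:E)%E -> lip_joined Y L a b.
Proof.
move=> L0 abL; apply: (lip_joined_lim (b := fun=> b)) => //; last first.
  exact: seq_cvg_for_cst.
move=> n; apply: length_dist_lt_lip_joined; apply: le_lt_trans abL _.
by rewrite lte_fin ltrDl invr_gt0.
Qed.

(** * Geodesics and completeness *)

Hypothesis dY_finite : forall y y' : X, Y y -> Y y' -> (length_dist Y y y' < +oo)%E.

Let dY_EFin (y y' : X) : Y y -> Y y' ->
  exists2 L : R, 0 <= L & length_dist Y y y' = L%:E.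
Proof.
move=> Yy Yy'; have d0 := length_dist_ge0 Y y y'.
exists (fine (length_dist Y y y')); first exact: fine_ge0.
by rewrite fineK// ge0_fin_numE// dY_finite.
Qed.

(** A curve realizing the distance, rescaled to [0, 1], is a geodesic because no part of it can be
    shortened. *)
Lemma geodesic_length_dist : geodesic_dist Y (length_dist Y).
Proof.
move=> y y' Yy Yy'; have [L L0 dL] := dY_EFin Yy Yy'.
have [|c [c0 cL Yc lipc]] := @length_dist_lip_joined L y y' L0.
  by rewrite dL.
have tL01 t : 0 <= t <= 1 -> 0 <= t * L <= L.
  by move=> /andP[t0 t1]; rewrite mulr_ge0//= ler_piMl.
have Yg t : 0 <= t <= 1 -> Y (c (t * L)) by move=> t01; exact/Yc/tL01.
have dE s t : 0 <= s <= 1 -> 0 <= t <= 1 -> s <= t ->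
    exists2 r : R, r = (t - s) * L & lip_joined Y r (c (s * L)) (c (t * L)) /\
    length_dist Y (c (s * L)) (c (t * L)) = r%:E.
  move=> s01 t01 st; exists ((t - s) * L) => //.
  have /andP[sL0 sLL] := tL01 _ s01; have /andP[tL0 tLL] := tL01 _ t01.
  have stL : s * L <= t * L by rewrite ler_wpM2r.
  have lipst : lip_joined Y ((t - s) * L) (c (s * L)) (c (t * L)).
    by rewrite mulrBl; exact: lip_joined_sub Yc lipc _ _ _.
  split => //; have [r r0 dr] := dY_EFin (Yg _ s01) (Yg _ t01).
  apply/le_anti/andP; split.
    by apply: length_dist_le => //; rewrite mulr_ge0// subr_ge0.
  rewrite dr lee_fin.
  (* Replacing the middle part of [c] by a curve of length [r] cannot beat [L], so
     [r >= (t - s) * L]. *)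
  have : lip_joined Y (s * L + r + (L - t * L)) y y'.
    apply: (@lip_joined_trans _ _ _ _ _ _ (c (t * L))).
    - by rewrite addr_ge0.
    - by rewrite subr_ge0.
    - apply: (@lip_joined_trans _ _ _ _ _ _ (c (s * L))) => //.
      + have := lip_joined_sub Yc lipc (lexx 0) sL0 sLL.
        by rewrite c0 subr0.
      + by apply: length_dist_lip_joined => //; rewrite dr.
    - have := lip_joined_sub Yc lipc tL0 tLL (lexx L).
      by rewrite cL.
  move=> /length_dist_le; rewrite dL lee_fin => /(_ _).
  have -> : 0 <= s * L + r + (L - t * L) by rewrite addr_ge0 ?subr_ge0// addr_ge0.
  by move=> /(_ isT); rewrite mulrBl; lra.
exists (fun t => c (t * L)); split => //.
- by rewrite mul0r.
- by rewrite mul1r.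
- move=> s t s01 t01; rewrite dL -EFinM; split; last exact: ltry.
  have [st|/ltW ts] := leP s t.
    by have [r -> [_ ->]] := dE s t s01 t01 st; rewrite ger0_norm ?subr_ge0.
  (* For [t <= s] the curves realizing the distances are reversed. *)
  have [r rE [lipr dr]] := dE t s t01 s01 ts.
  have r0 : 0 <= r by rewrite rE mulr_ge0// subr_ge0.
  rewrite distrC ger0_norm ?subr_ge0// -rE.
  apply/le_anti/andP; split; first exact/length_dist_le/lip_joined_sym.
  have [r' r'0 dr'] := dY_EFin (Yg _ s01) (Yg _ t01).
  rewrite dr' -dr; apply: length_dist_le => //; apply: lip_joined_sym.
  by apply: length_dist_lip_joined => //; rewrite dr'.
Qed.

(** A tail of the sequence is [d_X]-bounded, hence has a sigma-limit [y] along a subsequence; lower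
    semicontinuity in the endpoint passes the Cauchy bound to [y]. *)
Lemma complete_length_dist : complete_dist Y (length_dist Y).
Proof.
move=> u Yu cu; have [N NP] := cu 1 ltr01.
have [n|phi hphi [y uy]] := sigma_compact (metric_bounded_ball (u N) 1)
    (u := fun n => u (N + n)%N).
  have [c [<- <- _ lipc]] : lip_joined Y 1 (u N) (u (N + n)%N).
    by apply: length_dist_lt_lip_joined; rewrite NP// leq_addr.
  by rewrite /= (le_trans (lipc _ _ _ _ _))// subr0.
have Yy : Y y by apply: seq_cvg_for_closed Y_closed _ uy => n; exact: Yu.
exists y => //.
have uley e : 0 < e -> exists M, forall n, (M <= n)%N ->
    (length_dist Y (u n) y <= e%:E)%E.
  move=> e0; have [M MP] := cu e e0; exists M => n Mn.
  apply: length_dist_le; first exact: ltW.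
  (* The shift by [M] makes every index at least [M], where the Cauchy bound [e] applies. *)
  apply: (lip_joined_lim (b := fun k => u (N + phi (M + k))%N)); first exact: ltW.
    move=> k; apply: (@lip_joined_le _ _ _ e); first exact: ltW.
      by rewrite lerDl invr_ge0.
    apply: length_dist_lt_lip_joined; apply: MP => //.
    rewrite (leq_trans _ (leq_addl _ _))// (leq_trans _ (homo_ltn_ge_id hphi _))//.
    exact: leq_addr.
  apply: seq_cvg_for_subseq uy => K; exists K => n' Kn'.
  by exists (M + n')%N => //; rewrite (leq_trans Kn')// leq_addl.
apply/fine_cvgP; split.
  by apply: nearW => n; have [r _ ->] := dY_EFin (Yu n) Yy.
apply/cvgrPdist_le => e e0; have [M MP] := uley e e0.
exists M => // n /= /MP; have [r r0 dr] := dY_EFin (Yu n) Yy.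
by rewrite /= dr lee_fin sub0r normrN ger0_norm.
Qed.

End Compactness.

Theorem proposition3p1 (R : realType) (X : metricType R)
    (X_complete : complete_metric X) (Y : set X)
    (sigma : topology_on X)
    (sigma_hausdorff : hausdorff_topology sigma)
    (sigma_compact : forall B : set X,
      metric_bounded B -> relatively_seq_compact sigma B)
    (sigma_lsc : mdist_seq_lsc sigma)
    (Y_closed : closed_for sigma Y)
    (dY_finite : forall y y' : X, Y y -> Y y' -> (length_dist Y y y' < +oo)%E) :
  complete_geodesic Y (length_dist Y).
Proof.
split; [exact: complete_length_dist sigma_compact sigma_lsc Y_closed dY_finite|].
exact: geodesic_length_dist sigma_compact sigma_lsc Y_closed dY_finite.
Qed.
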